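(* Let $p,q$ be coprime integers with $q\ge 3$ odd. Start from an arbitrary expansion of $p/q$ and repeatedly apply the following length-decreasing reductions (in any order, and with possible intermediate coefficients equal to $0$), where $\varepsilon=\pm1$ and a coefficient block always means a block of consecutive coefficients: (1) Removal of a coefficient $0$: $$[\dots,a,0,b,\dots]=[\dots,a+b,\dots],\qquad [\dots,a,b,0]=[\dots,a],\qquad [0,a,b,\dots]=-a+[b,\dots].$$ (2) Removal of a coefficient $\varepsilon$: $$[\dots,a,\varepsilon,b,\dots]=[\dots,a-\varepsilon,b-\varepsilon,\dots],\quad [\dots,a,\varepsilon]=[\dots,a-\varepsilon],\quad r+[\varepsilon,a,\dots]=(r+\varepsilon)+[a-\varepsilon,\dots].$$ (3) Removal of a block $2\varepsilon,3\varepsilon,\dots,3\varepsilon,2\varepsilon$ of length $m\ge 2$ (first and last entries $2\varepsilon$, the $m-2$ entries in between all $3\varepsilon$; for $m=2$ the block is $2\varepsilon,2\varepsilon$): $$[\dots,a,\underbrace{2\varepsilon,3\varepsilon,\dots,3\varepsilon,2\varepsilon}_{m},b,\dots]=[\dots,a-\varepsilon,\underbrace{-3\varepsilon,\dots,-3\varepsilon}_{m-1},b-\varepsilon,\dots],$$ $$[\dots,a,\underbrace{2\varepsilon,3\varepsilon,\dots,3\varepsilon,2\varepsilon}_{m}]=[\dots,a-\varepsilon,\underbrace{-3\varepsilon,\dots,-3\varepsilon}_{m-1}],$$ $$r+[\underbrace{2\varepsilon,3\varepsilon,\dots,3\varepsilon,2\varepsilon}_{m},a,\dots]=(r+\varepsilon)+[\underbrace{-3\varepsilon,\dots,-3\varepsilon}_{m-1},a-\varepsilon,\dots],$$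 $$r+[\underbrace{2\varepsilon,3\varepsilon,\dots,3\varepsilon,2\varepsilon}_{m}]=(r+\varepsilon)+[\underbrace{-3\varepsilon,\dots,-3\varepsilon}_{m-1}].$$ Let $p/q=r+[b_1,b_2,\dots,b_n]$ be an expansion obtained in this way to which none of these reductions can be applied any more. Then $n$ is the minimal length of all expansions of $p/q$.
   Context: For integers $r,b_1,\dots,b_n$ write $$r+[b_1,\dots,b_n]=r+\cfrac{1}{b_1-\cfrac{1}{b_2-\cfrac{1}{\ddots-\cfrac{1}{b_n}}}}$$ (a subtractive continued fraction), i.e. $r+f_{b_1}\circ\cdots\circ f_{b_n}(0)$ with $f_b(x)=1/(b-x)$, evaluated in $\mathbb{Q}\cup\{\infty\}$ with the usual conventions $1/0=\infty$, $1/\infty=0$. An expansion of $p/q$ is such an expression equal to $p/q$ with $r,b_i\in\mathbb{Z}$ and all $b_i\neq 0$; its length is $n$, and the $b_i$ are its coefficients. (During the reductions zero coefficients may temporarily appear; they are removed by (1).) *)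

(* Defs.v *)
From mathcomp Require Import all_boot all_order all_algebra.
From Stdlib Require Import Relation_Operators.

Set Implicit Arguments.
Unset Strict Implicit.
Unset Printing Implicit Defensive.

Import Order.TTheory GRing.Theory Num.Theory.
Local Open Scope ring_scope.

(* Q extended by a point at infinity, represented by None. *)
Definition ratinf := option rat.

(* Inversion with 1/0 = oo and 1/oo = 0. *)
Definition ratinf_inv (x : ratinf) : ratinf :=
  if x is Some y then (if y == 0 then None else Some y^-1) else Some 0.

(* f_b(x) = 1 / (b - x), where b - oo = oo. *)
Definition cf_step (b : int) (x : ratinf) : ratinf :=
  ratinf_inv (omap (fun y : rat => b%:~R - y) x).

(* (r, [:: b_1; ...; b_n]) stands for the formal expression
   r + [b_1, ..., b_n]; zero coefficients are allowed. *)
Definition cfrac := (int * seq int)%type.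

(* r + f_{b_1} (... (f_{b_n} 0)), where r + oo = oo. *)
Definition cf_value (x : cfrac) : ratinf :=
  omap (fun y : rat => x.1%:~R + y) (foldr cf_step (Some 0) x.2).

Definition expansion_of (p q : int) (x : cfrac) : Prop :=
  cf_value x = Some (p%:~R / q%:~R) /\ all (fun b => b != 0) x.2.

Definition is_sign (e : int) : Prop := e = 1 \/ e = -1.

(* 2e, 3e, ..., 3e, 2e, of length m when 2 <= m. *)
Definition block23 (e : int) (m : nat) : seq int :=
  (2 * e) :: rcons (nseq (m - 2) (3 * e)) (2 * e).

(* -3e, ..., -3e, of length m - 1. *)
Definition block3 (e : int) (m : nat) : seq int := nseq (m - 1) (- (3 * e)).

(* One reduction step; s and t are the possibly empty unchanged parts. *)
Inductive reduction : cfrac -> cfrac -> Prop :=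
| red_zero_mid (r a b : int) (s t : seq int) :
    reduction (r, s ++ [:: a, 0, b & t]) (r, s ++ (a + b) :: t)
| red_zero_last (r a b : int) (s : seq int) :
    reduction (r, s ++ [:: a; b; 0]) (r, s ++ [:: a])
| red_zero_first (r a b : int) (t : seq int) :
    reduction (r, [:: 0, a, b & t]) (r - a, b :: t)
| red_one_mid (r a e b : int) (s t : seq int) :
    is_sign e ->
    reduction (r, s ++ [:: a, e, b & t]) (r, s ++ [:: a - e, b - e & t])
| red_one_last (r a e : int) (s : seq int) :
    is_sign e ->
    reduction (r, s ++ [:: a; e]) (r, s ++ [:: a - e])
| red_one_first (r e a : int) (t : seq int) :
    is_sign e ->
    reduction (r, [:: e, a & t]) (r + e, (a - e) :: t)
| red_block_mid (r a e b : int) (s t : seq int) (m : nat) :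
    is_sign e -> (2 <= m)%N ->
    reduction (r, s ++ a :: block23 e m ++ b :: t)
              (r, s ++ (a - e) :: block3 e m ++ (b - e) :: t)
| red_block_last (r a e : int) (s : seq int) (m : nat) :
    is_sign e -> (2 <= m)%N ->
    reduction (r, s ++ a :: block23 e m) (r, s ++ (a - e) :: block3 e m)
| red_block_first (r e a : int) (t : seq int) (m : nat) :
    is_sign e -> (2 <= m)%N ->
    reduction (r, block23 e m ++ a :: t) (r + e, block3 e m ++ (a - e) :: t)
| red_block_all (r e : int) (m : nat) :
    is_sign e -> (2 <= m)%N ->
    reduction (r, block23 e m) (r + e, block3 e m).

Definition reduces_to : cfrac -> cfrac -> Prop := clos_refl_trans cfrac reduction.

Definition irreducible_cfrac (x : cfrac) : Prop := forall y, ~ reduction x y.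

Definition minimal_length (p q : int) (n : nat) : Prop :=
  (exists x, expansion_of p q x /\ size x.2 = n) /\
  (forall x, expansion_of p q x -> (n <= size x.2)%N).

(* Main.v *)
Require Import Defs.
From mathcomp Require Import all_boot all_order all_algebra.
From mathcomp Require Import zify ring.
Set Implicit Arguments.
Unset Strict Implicit.
Unset Printing Implicit Defensive.
Import Order.TTheory GRing.Theory Num.Theory.
Local Open Scope ring_scope.

(* The convergents of an expansion form a path in the Farey graph from oo to
   p/q, and length n corresponds to a path with n + 1 edges.  The distance from
   oo of a mediant exceeds the smaller distance of its two parents by at least 1,
   because every path to it must use one of the parents.  Around a convergent v_i
   the next convergent b v_i - v_(i-1) is found by walking along the fan of
   neighbours of v_i; following the two sides of the strip of triangles shows that
   the distance grows by 1 at every step unless |b| < 2 or b completes a block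
   2e, 3e, ..., 3e, 2e. *)

(** * Continued fractions in homogeneous coordinates *)

(** The matrix of f_b acting on coordinates [(x, y)] of x / y; [(1, 0)] is oo. *)
Definition cf_mul (b : int) (v : int * int) : int * int :=
  (v.2, b * v.2 - v.1).

Definition shift (e : int) (v : int * int) : int * int :=
  (v.1 + e * v.2, v.2).

Definition shear (e : int) (v : int * int) : int * int :=
  (v.1, v.2 - e * v.1).

Definition cf_vec (x : cfrac) : int * int :=
  shift x.1 (foldr cf_mul (0, 1) x.2).

Definition frac (v : int * int) : ratinf :=
  if v.2 == 0 then None else Some (v.1%:~R / v.2%:~R).

Definition same_line (v w : int * int) : Prop := v = w \/ v = - w.

Lemma same_line_refl v : same_line v v.
Proof. by left. Qed.

Lemma same_line_trans u v w :
  same_line u v -> same_line v w -> same_line u w.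
Proof.
move=> [->|->] [->|->]; rewrite ?opprK; by [left | right].
Qed.

Lemma cf_mulN b v : cf_mul b (- v) = - cf_mul b v.
Proof. by case: v => x y; congr pair => /=; ring. Qed.

Lemma shiftN e v : shift e (- v) = - shift e v.
Proof. by case: v => x y; congr pair => /=; ring. Qed.

Lemma same_line_foldr s v w :
  same_line v w -> same_line (foldr cf_mul v s) (foldr cf_mul w s).
Proof.
move=> vw; elim: s => [|b s [IH|IH]] //=; rewrite IH ?cf_mulN; by [left | right].
Qed.

Lemma same_line_shift e v w :
  same_line v w -> same_line (shift e v) (shift e w).
Proof. case=> ->; rewrite ?shiftN; by [left | right]. Qed.

Lemma cf_mul_shift a e v : cf_mul a (shift e v) = cf_mul (a - e) v.
Proof. by case: v => x y; congr pair => /=; ring. Qed.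

Lemma shear_cf_mul b e v : shear e (cf_mul b v) = cf_mul (b - e) v.
Proof. by case: v => x y; congr pair => /=; ring. Qed.

Lemma shift_shift r e v : shift r (shift e v) = shift (r + e) v.
Proof. by case: v => x y; congr pair => /=; ring. Qed.

Lemma shear01 e : shear e (0, 1) = (0, 1).
Proof. by congr pair => /=; ring. Qed.

(** * Invariance of the value under the reductions *)

(* As Moebius maps, f_w = (y |-> y + e) o f_w' o (y |-> y / (1 - e y)). *)
Definition flips (e : int) (w w' : seq int) : Prop :=
  forall v, same_line (foldr cf_mul v w) (shift e (foldr cf_mul (shear e v) w')).

Lemma flips_one e : is_sign e -> flips e [:: e] [::].
Proof.
by case=> -> [x y]; [left | right]; congr pair => /=; ring.
Qed.

(* [cf_mul (3 * e)] and [cf_mul (- (3 * e))] are conjugate, up to sign, by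
   [shift (- e) \o cf_mul (2 * e)]. *)
Lemma flips_block e m : is_sign e -> (2 <= m)%N ->
  flips e (block23 e m) (block3 e m).
Proof.
case: m => [|[|k]] // he _ v.
rewrite /block23 /block3 !subSS !subn0 /= -cats1 foldr_cat /=.
elim: k v => [|k IH] v.
  by case: v => x y; case: he => ->; [right | left]; congr pair => /=; ring.
have shK w : shift e (shift (- e) w) = w.
  by case: w => x y; congr pair => /=; ring.
have conj w : cf_mul (2 * e) (cf_mul (3 * e) w) =
    - shift e (cf_mul (- (3 * e)) (shift (- e) (cf_mul (2 * e) w))).
  by case: w => x y; case: he => ->; congr pair => /=; ring.
rewrite /= conj.
have shKN w : shift (- e) (shift e w) = w.
  by case: w => x y; congr pair => /=; ring.
case: (IH v) => ->; rewrite ?shiftN shKN ?cf_mulN ?shiftN; [by right | left].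
exact: opprK.
Qed.

(** The left neighbour absorbs the translation ([cf_mul_shift]), the right one the shear
    ([shear_cf_mul]). *)
Lemma flips_mid r a e b s t w w' : flips e w w' ->
  same_line (cf_vec (r, s ++ a :: w ++ b :: t))
            (cf_vec (r, s ++ (a - e) :: w' ++ (b - e) :: t)).
Proof.
move=> h; apply: same_line_shift; rewrite !foldr_cat; apply: same_line_foldr.
rewrite /= !foldr_cat /= -cf_mul_shift -shear_cf_mul.
exact: (@same_line_foldr [:: a]).
Qed.

(** With nothing on the right, the shear vanishes because it fixes [(0, 1)]. *)
Lemma flips_last r a e s w w' : flips e w w' ->
  same_line (cf_vec (r, s ++ a :: w)) (cf_vec (r, s ++ (a - e) :: w')).
Proof.
move=> h; apply: same_line_shift; rewrite !foldr_cat; apply: same_line_foldr.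
rewrite /= -cf_mul_shift -{2}(shear01 e).
exact: (@same_line_foldr [:: a]).
Qed.

Lemma flips_first r e a t w w' : flips e w w' ->
  same_line (cf_vec (r, w ++ a :: t)) (cf_vec (r + e, w' ++ (a - e) :: t)).
Proof.
move=> h; rewrite /cf_vec /= -shift_shift !foldr_cat /= -shear_cf_mul.
exact: same_line_shift.
Qed.

Lemma flips_all r e w w' : flips e w w' ->
  same_line (cf_vec (r, w)) (cf_vec (r + e, w')).
Proof.
move=> h; rewrite /cf_vec /= -shift_shift -{2}(shear01 e).
exact: same_line_shift.
Qed.

Lemma reduction_same_line x y :
  reduction x y -> same_line (cf_vec x) (cf_vec y).
Proof.
case=> {x y}.
- move=> r a b s t; apply: same_line_shift; rewrite !foldr_cat.
  apply: same_line_foldr; right => /=.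
  by case: (foldr _ _ t) => x y; congr pair => /=; ring.
- move=> r a b s; apply: same_line_shift; rewrite !foldr_cat.
  by apply: same_line_foldr; right; congr pair => /=; ring.
- move=> r a b t; right; rewrite /cf_vec /=.
  by case: (foldr _ _ t) => x y; congr pair => /=; ring.
- by move=> r a e b s t /flips_one; apply: flips_mid.
- by move=> r a e s /flips_one; apply: flips_last.
- by move=> r e a t /flips_one /flips_first; apply.
- by move=> r a e b s t m he hm; apply/flips_mid/flips_block.
- by move=> r a e s m he hm; apply/flips_last/flips_block.
- by move=> r e a t m he hm; apply/flips_first/flips_block.
- by move=> r e m he hm; apply/flips_all/flips_block.
Qed.

Lemma reduces_to_same_line x y :
  reduces_to x y -> same_line (cf_vec x) (cf_vec y).
Proof.
elim=> {x y} [x y /reduction_same_line //|x|x y z _ + _].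
  exact: same_line_refl.
exact: same_line_trans.
Qed.

Lemma cf_mul_eq0 b v : (cf_mul b v == 0) = (v == 0).
Proof.
case: v => x y; apply/eqP/eqP => -[]; last by move=> -> ->; congr pair => /=; ring.
by move=> /= -> h; congr pair; lia.
Qed.

Lemma foldr_cf_mul_neq0 t : foldr cf_mul (0, 1) t != 0.
Proof. by elim: t => //= b t IH; rewrite cf_mul_eq0. Qed.

Lemma cf_step_frac b v : v != 0 -> cf_step b (frac v) = frac (cf_mul b v).
Proof.
case: v => x y; rewrite /frac /cf_step /=.
have [->|y0] := eqVneq y 0.
  rewrite mulr0 sub0r oppr_eq0 => xy0.
  have -> : (x == 0) = false by apply/negP => /eqP x0; rewrite x0 in xy0.
  by rewrite /= mul0r.
move=> _ /=.
have yQ : y%:~R != 0 :> rat by rewrite intr_eq0.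
have -> : b%:~R - x%:~R / y%:~R = (b * y - x)%:~R / y%:~R :> rat.
  by rewrite rmorphB rmorphM /=; field.
rewrite mulf_eq0 invr_eq0 (negPf yQ) orbF intr_eq0.
by case: ifP => // _; rewrite invf_div.
Qed.

Lemma cf_value_vec x : cf_value x = frac (cf_vec x).
Proof.
case: x => r t; rewrite /cf_value /cf_vec /=.
have -> : foldr cf_step (Some 0) t = frac (foldr cf_mul (0, 1) t).
  elim: t => [|b t IH] /=; first by rewrite /frac /= mul0r.
  by rewrite IH cf_step_frac // foldr_cf_mul_neq0.
case: (foldr _ _ t) => x y; rewrite /frac /=.
have [//|y0] := eqVneq y 0.
have yQ : y%:~R != 0 :> rat by rewrite intr_eq0.
by congr Some; rewrite rmorphD rmorphM /=; field.
Qed.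

(** * Convergents as paths in the Farey graph *)

Definition det (u v : int * int) : int := u.1 * v.2 - u.2 * v.1.

(** Reading from the left makes the intermediate vectors the convergents, which [foldr] does not
    show. *)
Fixpoint cf_conv (u v : int * int) (t : seq int) : int * int :=
  if t is b :: t' then cf_conv v (b * v.1 - u.1, b * v.2 - u.2) t' else v.

Lemma cf_conv_foldr u v t : let w := foldr cf_mul (0, 1) t in
  cf_conv u v t = (w.2 * v.1 - w.1 * u.1, w.2 * v.2 - w.1 * u.2).
Proof.
elim: t u v => [|b t IH] u v /=; first by case: v => x y /=; congr pair; ring.
by rewrite IH /=; congr pair; ring.
Qed.

Lemma cf_vec_conv r t : cf_vec (r, t) = cf_conv (-1, 0) (r, 1) t.
Proof. by rewrite cf_conv_foldr /cf_vec; congr pair => /=; ring. Qed.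

(* Distance in the Farey graph: [reach n v] means that a path of length [n]
   leads from [oo] to the vertex represented by the primitive vector [v]. *)
Inductive reach : nat -> int * int -> Prop :=
| reach0 e : is_sign e -> reach 0 (e, 0)
| reachS n u v : reach n u -> is_sign (det u v) -> reach n.+1 v.

Definition far (k : nat) (v : int * int) : Prop :=
  forall n, reach n v -> (k <= n)%N.

Lemma reachN n v : reach n v -> reach n (- v).
Proof.
case=> [e he|{}n u {}v hu huv].
  by apply: reach0; case: he => ->; [right | left].
apply: (reachS hu); move: huv; rewrite /det /is_sign /=; lia.
Qed.

Lemma farN k v : far k v -> far k (- v).
Proof. by move=> h n /reachN; rewrite opprK; apply: h. Qed.

Lemma reach_cf_conv n u v t : reach n u -> is_sign (det u v) ->
  reach (n.+1 + size t) (cf_conv u v t).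
Proof.
elim: t n u v => [|b t IH] n u v hu huv /=; first by rewrite addn0; apply: reachS huv.
rewrite addnS -addSn; apply: IH; first exact: reachS huv.
by move: huv; rewrite /det /is_sign /=; lia.
Qed.

(** The extra edge is the one from oo to [r]. *)
Lemma reach_cf_vec r t : reach (size t).+1 (cf_vec (r, t)).
Proof.
rewrite cf_vec_conv -add1n; apply: reach_cf_conv; first by apply: reach0; right.
by right; rewrite /det /=; lia.
Qed.

Lemma reach_coprime n v : reach n v -> coprimez v.1 v.2.
Proof.
case=> [e he|{}n u {}v _ huv] /=; first by rewrite /coprimez gcdz0; case: he => ->.
apply/coprimezP; rewrite /det in huv.
case: huv => h; [exists (- u.2, u.1) | exists (u.2, - u.1)] => /=; lia.
Qed.

(** * Lower bounds for the Farey distance *)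

(* A path to [u + w] whose last edge starts beyond [u + w] comes from
   [u + k (u + w)] or [w + k (u + w)] with [k > 0]; its predecessors can then be
   replaced by closer ones, since these vertices are mediants as well. *)
Lemma reach_mediant n u w : is_sign (det u w) -> 0 < u.2 -> 0 < w.2 ->
  reach n (u + w) -> exists2 m, (m < n)%N & reach m u \/ reach m w.
Proof.
elim/ltn_ind: n u w => n IH u w uw u0 w0 hn.
have beyond (k : nat) x y : is_sign (det x y) -> 0 < x.2 -> 0 < y.2 ->
    reach n.-1 (x.1 + k%:Z * (x.1 + y.1), x.2 + k%:Z * (x.2 + y.2)) ->
    (0 < n)%N -> exists2 m, (m < n)%N & reach m x \/ reach m y.
  move=> xy x0 y0 hr n0; case: k hr => [|k] hr.
    by exists n.-1; [lia | left; rewrite !mul0r !addr0 -surjective_pairing in hr].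
  have n1 : (n.-1 < n)%N by lia.
  pose z := (x.1 + k%:Z * (x.1 + y.1), x.2 + k%:Z * (x.2 + y.2)).
  have zxy : det z (x + y) = det x y by rewrite /z /det /=; ring.
  have zE : (x.1 + k.+1%:Z * (x.1 + y.1), x.2 + k.+1%:Z * (x.2 + y.2)) = z + (x + y).
    by rewrite /z; congr pair => /=; ring.
  rewrite zE in hr.
  have [||||m hm hm'] := IH _ n1 z (x + y) => //.
  - by rewrite zxy.
  - by rewrite /z /=; nia.
  - by rewrite /=; lia.
  (* If [z] is the closer parent, one edge leads from it to [x + y]; either way [x + y] is reached
     in fewer than [n] steps and induction applies again. *)
  have [i hi hxy] : exists2 i, (i < n)%N & reach i (x + y).
    case: hm' => [hz|hv]; last by exists m => //; lia.
    by exists m.+1; [lia | apply: (reachS hz); rewrite zxy].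
  have [j hj hj'] := IH i hi x y xy x0 y0 hxy.
  by exists j => //; lia.
(* Solving in the basis [u], [w]: every neighbour of [u + w] is, up to sign, u + t (u + w). *)
have [t ht n0] : exists2 t : int,
    reach n.-1 (u.1 + t * (u.1 + w.1), u.2 + t * (u.2 + w.2)) & (0 < n)%N.
  move uwE : (u + w) hn => v hn; case: n v / hn uwE {IH beyond} => [e _ uwE|n z v hz hzv uwE].
    by have := congr1 snd uwE; rewrite /=; lia.
  have z1 : z.1 * det u w = det z w * u.1 - det z u * w.1 by rewrite /det; ring.
  have z2 : z.2 * det u w = det z w * u.2 - det z u * w.2 by rewrite /det; ring.
  have zwE : det z w = det z v - det z u by rewrite -uwE /det /=; ring.
  have sgnE a b : reach n (a, b) -> reach n (- a, - b) by apply: reachN.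
  have zr : reach n (z.1, z.2) by rewrite -surjective_pairing.
  have zrN := sgnE _ _ zr.
  have eqr a b a' b' : reach n (a, b) -> a' = a -> b' = b -> reach n (a', b').
    by move=> h -> ->.
  case: uw hzv => uwd [] zvd; rewrite zwE zvd uwd in z1 z2.
  - exists (- det z u) => //=; apply: eqr zr _ _; lia.
  - exists (det z u) => //=; apply: eqr zrN _ _; lia.
  - exists (- det z u) => //=; apply: eqr zrN _ _; lia.
  - exists (det z u) => //=; apply: eqr zr _ _; lia.
have [t0|t0] := leP 0 t.
  by case: t t0 ht => // k _ /beyond; apply.
(* For t = -(k + 1) the neighbour is, up to sign, w + k (u + w), so the roles of [u] and [w] are
   swapped. *)
have [k tE] : exists k : nat, t = - k.+1%:Z by exists `|t|.-1%N; lia.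
have [||m hm hm'] := beyond k w u _ w0 u0 _ n0.
- by move: uw; rewrite /is_sign /det; lia.
- move/reachN: ht; rewrite tE; congr (reach _ _); congr pair => /=; ring.
by exists m => //; case: hm'; [right | left].
Qed.

Lemma far_mediant k u w : is_sign (det u w) -> 0 < u.2 -> 0 < w.2 ->
  far k u -> far k w -> far k.+1 (u + w).
Proof.
move=> uw u0 w0 hu hw n /(reach_mediant uw u0 w0)[m mn].
by case=> [/hu|/hw] km; apply: leq_ltn_trans mn.
Qed.

Lemma farW k l v : (k <= l)%N -> far l v -> far k v.
Proof. by move=> kl h n /h; apply: leq_trans. Qed.

Lemma far1 v : v.2 != 0 -> far 1 v.
Proof. by move=> v0 n hn; case: hn v0. Qed.

Definition scale (c : int) (v : int * int) : int * int := (c * v.1, c * v.2).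

(** Every step is a mediant with [v], which is only known to be [k] away, so the bound rises once
    and then stays. *)
Lemma far_fan k h x v : is_sign (det x v) -> 0 < x.2 -> 0 < v.2 ->
  far k x -> far k v -> far (k + (0 < h)) (x + scale h%:Z v).
Proof.
move=> xv x0 v0 hx hv; have s0 : x + scale 0 v = x.
  by case: (x) => a b; congr pair => /=; ring.
elim: h => [|h IH] /=; first by rewrite addn0 s0.
have -> : x + scale h.+1%:Z v = (x + scale h%:Z v) + v.
  by congr pair => /=; ring.
rewrite addn1; apply: far_mediant => //; last by apply: farW IH; rewrite leq_addr.
- by rewrite (_ : det _ _ = det x v) // /det /=; ring.
- by rewrite /=; nia.
Qed.

(** * Growth of the distance along a reduced expansion *)

(* [al] records that the coefficients already read end in a block
   2e, 3e, ..., 3e, which one more 2e would complete. *)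
Fixpoint reduced_from (al : bool) (e : int) (t : seq int) : bool :=
  if t is b :: t' then
    [&& 2 <= `|b|, ~~ [&& al, `|b| == 2 & 0 < e * b] &
        reduced_from ((`|b| == 2) || [&& al, `|b| == 3 & 0 < e * b])
                     (sgz b) t']
  else true.

Lemma is_signM e e' : is_sign e -> is_sign e' -> is_sign (e * e').
Proof. by move=> [->|->] [->|->]; [left | right | right | left]. Qed.

(* Up to signs, u and v are the last two convergents; the parents of v are u and
   v - u, and [al] holds when v - u is as close to oo as u. *)
Lemma far_cf_conv t : forall n al e s u v,
  is_sign e -> is_sign s -> is_sign (det u v) -> 0 < u.2 < v.2 ->
  far n u -> far n.+1 v -> far (n + ~~ al) (v - u) ->
  reduced_from al e t ->
  far (n.+1 + size t) (cf_conv (scale (s * e) u) (scale s v) t).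
Proof.
have step b : 2 <= `|b| -> exists e' h, [/\ is_sign e', e' = sgz b & b = e' * (h%:Z + 2)].
  move=> b2; exists (sgz b), (`|b| - 2)%N; split=> //; last by lia.
  by rewrite /is_sign; lia.
elim: t => [|b t IH] n al e s u v he hs uv /andP[u0 uv0] hu hv hw.
  move=> _; rewrite addn0 /=; case: hs => ->.
    by rewrite (_ : scale 1 v = v) //; case: (v) => x y; congr pair => /=; ring.
  rewrite (_ : scale (-1) v = - v); first exact: farN.
  by case: (v) => x y; congr pair => /=; ring.
case/and3P=> /step [e' [h [he' e'E bE]]] nbad good.
(* The next vertex is x + (h + 1) v, with x the first vertex of the fan
   around v that is at distance n + 1 or more. *)
have next x h' : is_sign (det x v) -> 0 < x.2 -> far n.+1 x ->
    scale b v - scale e u = scale e' (x + scale h'.+1%:Z v) ->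
    reduced_from (h' == 0)%N e' t ->
    far (n.+1 + size (b :: t)) (cf_conv (scale (s * e) u) (scale s v) (b :: t)).
  move=> xv x0 hx E hred; rewrite /= addnS -addSn.
  have := IH n.+1 (h' == 0)%N e' (s * e') v (x + scale h'.+1%:Z v) he'.
  have -> : scale (s * e' * e') v = scale s v.
    by case: he' => ->; congr pair => /=; ring.
  have -> : scale (s * e') (x + scale h'.+1%:Z v) =
     (b * (scale s v).1 - (scale (s * e) u).1, b * (scale s v).2 - (scale (s * e) u).2).
    transitivity (scale s (scale b v - scale e u)).
      by rewrite E; congr pair => /=; ring.
    by congr pair => /=; ring.
  apply=> //.
  - exact: is_signM.
  - by move: xv; rewrite /is_sign /det /=; lia.
  - by rewrite /=; nia.
  - by rewrite -addn1; apply: (@far_fan n.+1 h'.+1) => //; lia.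
  (* The second parent is the start [x] of the fan exactly when h' = 0, which gives the new [al]. *)
  - rewrite (_ : _ - v = x + scale h'%:Z v); last by congr pair => /=; ring.
    by rewrite -lt0n; apply: far_fan => //; lia.
have hv' : far n v by apply: farW hv.
(* For equal signs, b v - e u = e' ((v - u) + (h + 1) v). *)
have [ee|ee] : e' = e \/ e' = - e by case: he he' => -> [] ->; by [left | right].
  have eb : 0 < e * b by rewrite bE ee; case: he => ->; lia.
  case: al hw nbad good => hw nbad good.
    (* Here [v - u] is only known to be [n] away, so one step of the fan is spent to get to n + 1;
       [nbad] guarantees that this step exists. *)
    have h0 : (0 < h)%N.
      by rewrite lt0n; apply: contra nbad => /eqP h0; rewrite eb bE h0; case: he' => ->.
    apply: (next ((v - u) + v) h.-1).
    - by move: uv; rewrite /is_sign /det /=; lia.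
    - by rewrite /=; lia.
    - rewrite addn0 in hw; apply: far_mediant => //.
      + by move: uv; rewrite /is_sign /det /=; lia.
      + by rewrite /=; lia.
      + by rewrite /=; lia.
    - rewrite -(prednK h0) in bE *; rewrite bE ee.
      by case: he => ->; congr pair => /=; ring.
    - by move: good; rewrite eb e'E; congr reduced_from; rewrite bE; case: he' => ->; lia.
  apply: (next (v - u) h).
  - by move: uv; rewrite /is_sign /det /=; lia.
  - by rewrite /=; lia.
  - by rewrite addn1 in hw.
  - by rewrite bE ee; case: he => ->; congr pair => /=; ring.
  - by move: good; rewrite orbF e'E; congr reduced_from; rewrite bE; case: he' => ->; lia.
(* For opposite signs, b v - e u = e' ((u + v) + (h + 1) v), and the mediant [u + v] is far enough
   whatever [al] is. *)
apply: (next (u + v) h).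
- by move: uv; rewrite /is_sign /det /=; lia.
- by rewrite /=; lia.
- by apply: far_mediant => //; lia.
- by rewrite bE ee; case: he => ->; congr pair => /=; ring.
- have eb : (0 < e * b) = false by rewrite bE ee; case: he => ->; lia.
  by move: good; rewrite eb !andbF orbF e'E; congr reduced_from; rewrite bE; case: he' => ->; lia.
Qed.

(** The first coefficient is read by hand: mediants need positive denominators, and oo has
    denominator 0. The fan around [r] starts at the integer r + e. *)
Lemma far_cf_vec r b : reduced_from false 0 b -> far (size b).+1 (cf_vec (r, b)).
Proof.
rewrite cf_vec_conv; case: b => [|b t] /=; first by move=> _; apply: far1.
rewrite !orbF => /andP[b2 good].
have he : is_sign (sgz b) by rewrite /is_sign; lia.
pose e := sgz b; pose h := (`|b| - 2)%N; have bE : b = e * (h%:Z + 2) by rewrite /e /h; lia.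
pose v : int * int := (r, 1); pose x : int * int := (r + e, 1).
have xv : is_sign (det x v) by move: he; rewrite /is_sign /det /= -/e; lia.
have hx : far 1 x by apply: far1.
have hv : far 1 v by apply: far1.
have := @far_cf_conv t 1 (h == 0)%N e e v (x + scale h.+1%:Z v) he he.
have -> : scale (e * e) v = v by rewrite /v /e; case: he => ->; congr pair => /=; ring.
have -> : scale e (x + scale h.+1%:Z v) = (b * r - -1, b * 1 - 0).
  by rewrite bE /x /v /scale; case: he; rewrite -/e => ->; congr pair => /=; ring.
apply=> //.
- by move: xv; rewrite /is_sign /det /=; lia.
- by rewrite -[2%N]/(1 + (0 < h.+1))%N; apply: far_fan.
- rewrite (_ : _ - v = x + scale h%:Z v); last by congr pair => /=; ring.
  by rewrite -lt0n; apply: far_fan.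
- by move: good; congr reduced_from; lia.
Qed.

(** * From irreducible to reduced expansions *)

(** [s] is the part already read; a coefficient failing the [al] test would complete a block begun
    in [s]. *)
Lemma reduced_from_irreducible t : forall (s : seq int) (al : bool) (e : int),
  {in t, forall x, 2 <= `|x|} ->
  (forall s' e' m t', is_sign e' -> (2 <= m)%N ->
     s ++ t <> s' ++ block23 e' m ++ t') ->
  (al -> is_sign e /\ exists s' k, s = s' ++ 2 * e :: nseq k (3 * e)) ->
  reduced_from al e t.
Proof.
elim: t => [|b t IH] //= s al e hb hnb hal.
have b2 : 2 <= `|b| by apply: hb; rewrite inE eqxx.
rewrite b2 /=; apply/andP; split.
  apply/negP=> /and3P[/hal[he [s' [k sE]]] /eqP bb eb].
  have bE : b = 2 * e by case: he eb => ->; lia.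
  apply: (hnb s' e k.+2 t he) => //.
  by rewrite sE bE /block23 !subSS subn0 -catA /= -cats1 -catA.
apply: (IH (rcons s b)) => [x xt|s' e' m t' he' hm|].
- by apply: hb; rewrite inE xt orbT.
- by rewrite cat_rcons; apply: hnb.
- have he' : is_sign (sgz b) by rewrite /is_sign; lia.
  case/orP=> [/eqP bb|/and3P[/hal[he [s' [k sE]]] /eqP bb eb]]; split=> //.
    by exists s, 0%N; rewrite cats1; congr rcons; lia.
  have eE : sgz b = e by case: he eb => ->; lia.
  exists s', k.+1; rewrite sE eE rcons_cat rcons_cons; congr (_ ++ _ :: _).
  have -> : b = 3 * e by rewrite -eE; lia.
  by rewrite -[RHS]/(nseq (1 + k) _) addnC nseqD cats1.
Qed.

Lemma irreducible_block_free r s e m t :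
  irreducible_cfrac (r, s ++ block23 e m ++ t) ->
  is_sign e -> ~ (2 <= m)%N.
Proof.
move=> hirr he hm; case/lastP: s hirr => [|s a]; case: t => [|b t].
- by rewrite cats0 => /(_ (r + e, block3 e m)); apply; constructor.
- by move/(_ (r + e, block3 e m ++ (b - e) :: t)); apply; constructor.
- rewrite cats0 cat_rcons => /(_ (r, s ++ (a - e) :: block3 e m)).
  by apply; constructor.
- rewrite cat_rcons => /(_ (r, s ++ (a - e) :: block3 e m ++ (b - e) :: t)).
  by apply; constructor.
Qed.

(** A coefficient 0 or ±1 resists removal only in [0], [0, a], [a, 0] and [±1], whose denominators
    are 0 or ±1. *)
Lemma irreducible_ge2 r l : irreducible_cfrac (r, l) ->
  2 <= `|(cf_vec (r, l)).2| ->
  {in l, forall x, 2 <= `|x|}.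
Proof.
move=> hirr hden x /splitPr lE; case: lE hirr hden => s t hirr hden.
have [//|x2] := leP 2 `|x|; exfalso.
have [x0|x1] : x = 0 \/ is_sign x by rewrite /is_sign; lia.
  subst x; case/lastP: s hirr hden => [|s a].
    case: t => [|a [|b t]]; last by move/(_ (r - a, b :: t)) => h _; apply: h; constructor.
    1,2: by move=> _ /=; lia.
  case: t => [|b t]; last first.
    by rewrite cat_rcons => /(_ (r, s ++ (a + b) :: t)) h _; apply: h; constructor.
  case/lastP: s => [|s c]; first by move=> _ /=; lia.
  rewrite !cat_rcons => /(_ (r, s ++ [:: c])) h _; apply: h; constructor.
case/lastP: s hirr hden => [|s a]; case: t => [|b t].
- by move=> _ /=; case: x1 => ->.
- by move/(_ (r + x, (b - x) :: t)) => h _; apply: h; constructor.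
- by rewrite cat_rcons => /(_ (r, s ++ [:: a - x])) h _; apply: h; constructor.
- by rewrite cat_rcons => /(_ (r, s ++ [:: a - x, b - x & t])) h _; apply: h; constructor.
Qed.

(** * Minimality *)

(** Both vectors are primitive ([reach_coprime]), so equal quotients force equality up to sign. *)
Lemma expansion_same_line p q x : coprimez p q -> 3 <= q ->
  expansion_of p q x -> same_line (cf_vec x) (p, q).
Proof.
move=> pq q3 [+ _]; case: x => r t; rewrite cf_value_vec /frac.
have := reach_coprime (reach_cf_vec r t).
case: (cf_vec _) => a b /= ab; case: eqVneq => // b0 [] /eqP.
have q0 : q != 0 by lia.
rewrite eqr_div ?intr_eq0 // -!intrM eqr_int => /eqP E.
have qb : (q %| b)%Z.
  by rewrite -(Gauss_dvdzr b (_ : coprimez q p)) 1?coprimez_sym // -E dvdz_mull.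
have bq : (b %| q)%Z.
  by rewrite -(Gauss_dvdzr q (_ : coprimez b a)) 1?coprimez_sym // E dvdz_mull.
have : `|b|%N = `|q|%N by apply/eqP; rewrite eqn_dvd; apply/andP; split.
move=> bqE; have [bE|bE] : b = q \/ b = - q by lia.
  by left; congr pair => //; nia.
by right; congr pair => //=; nia.
Qed.

Theorem theorem2p2 (p q : int) (hpq : coprimez p q) (hq3 : 3 <= q)
    (hqodd : odd `|q|%N) (x : cfrac) (hx : expansion_of p q x)
    (r : int) (b : seq int) (hred : reduces_to x (r, b))
    (hirr : irreducible_cfrac (r, b)) :
  minimal_length p q (size b).
Proof.
have bpq : same_line (p, q) (cf_vec (r, b)).
  apply: same_line_trans (reduces_to_same_line hred).
  by case: (expansion_same_line hpq hq3 hx) => ->; rewrite /same_line ?opprK; by [left|right].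
have b2 : {in b, forall c, 2 <= `|c|}.
  apply: (irreducible_ge2 hirr).
  have [->|->] : (cf_vec (r, b)).2 = q \/ (cf_vec (r, b)).2 = - q; try lia.
  by case: bpq => [<-|/(congr1 -%R)]; [left | rewrite opprK => <-; right].
have good : reduced_from false 0 b.
  apply: (@reduced_from_irreducible b [::]) => // s e m t he hm /= bE.
  by move: hirr; rewrite bE => /irreducible_block_free/(_ he).
split.
  exists (r, b); split=> //; split; last by apply/allP => c /b2; lia.
  case: hx => <- _; rewrite !cf_value_vec.
  have vN v : frac (- v) = frac v.
    by case: v => a c; rewrite /frac /= oppr_eq0 !rmorphN /= invrN mulrNN.
  by case: (reduces_to_same_line hred) => ->; rewrite ?vN.
move=> [r' c] /(expansion_same_line hpq hq3) cpq.
(* A competitor gives a path of [size c + 1] edges to p/q, while [hfar] demands at least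
   [size b + 1]. *)
have : reach (size c).+1 (cf_vec (r', c)) := reach_cf_vec r' c.
have hfar := far_cf_vec (r := r) good.
case: (same_line_trans cpq bpq) => -> /=; first by move/hfar.
by move/(farN hfar).
Qed.
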